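(* Let $n\ge2$, $k\ge1$. The John ellipsoid (maximum-volume ellipsoid contained in) of $\overline C$, viewed as a convex body in the affine hyperplane $M$ with the Euclidean structure induced by $\langle f,g\rangle=\int_{S^{n-1}}fg\,d\sigma$, is the ball $\{f\in M:\|f-r^{2k}\|\le \rho\}$ with center $r^{2k}=(x_1^2+\dots+x_n^2)^k$ and radius \[ \rho=\frac{1}{\sqrt{\binom{n+2k-1}{2k}-1}} . \]
   Context: $P_{n,2k}$ is the space of real forms of degree $2k$ in $n$ variables; $\sigma$ is the rotation-invariant probability measure on $S^{n-1}$; $\|f\|=\langle f,f\rangle^{1/2}$. $M=\{f\in P_{n,2k}:\int_{S^{n-1}}f\,d\sigma=1\}$, $C$ is the cone of forms in $P_{n,2k}$ nonnegative on $\mathbb R^n$, and $\overline C=C\cap M$. *)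

(* Defs.v *)
From HB Require Import structures.
From mathcomp Require Import all_boot all_order all_algebra.
From mathcomp Require Import mpoly.
From mathcomp Require Import all_classical all_reals all_analysis.

Set Implicit Arguments.
Unset Strict Implicit.
Unset Printing Implicit Defensive.

Import Order.TTheory GRing.Theory Num.Theory.
Import numFieldNormedType.Exports.
Local Open Scope classical_set_scope.
Local Open Scope ring_scope.

Notation Rn R n := (g_sigma_algebraType (@open 'rV[R]_n)).
Notation poly R n := (mpoly.mpoly n R).

Section Defs.
Variables (R : realType) (n : nat).
Local Notation Rn := (Rn R n).
Local Notation poly := (poly R n).

Definition sqnorm (x : 'rV[R]_n) : R := \sum_(i < n) x ord0 i ^+ 2.

Definition sphere : set Rn := [set x : Rn | sqnorm x = 1].

Definition is_rotation (Q : 'M[R]_n) : Prop := Q *m Q^T = 1%:M /\ \det Q = 1.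

Definition rot_inv_sphere_prob (sigma : probability Rn R) : Prop :=
  sigma sphere = 1%E /\
  forall Q : 'M[R]_n, is_rotation Q ->
    forall A : set Rn, measurable A ->
      sigma ((fun x : Rn => (x *m Q : Rn)) @^-1` A) = sigma A.

Definition ev (p : poly) (x : 'rV[R]_n) : R := mpoly.meval (fun i => x ord0 i) p.

Definition is_form (d : nat) (p : poly) : bool :=
  p \in @mpoly.ishomog1 n R d (mpoly.mpoly_mdeg__canonical__mpoly_Measure n).

Variable sigma : probability Rn R.

Definition sint (f : 'rV[R]_n -> R) : R :=
  Rintegral sigma sphere (fun x : Rn => f x).

Definition inner (p q : poly) : R := sint (fun x => ev p x * ev q x).
Definition pnorm (p : poly) : R := Num.sqrt (inner p p).

Variable k : nat.

Definition Mset : set poly := [set f | is_form (2 * k) f /\ sint (ev f) = 1].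
Definition M0 : set poly := [set f | is_form (2 * k) f /\ sint (ev f) = 0].
Definition Cset : set poly :=
  [set f | is_form (2 * k) f /\ forall x : 'rV[R]_n, 0 <= ev f x].
Definition Cbar : set poly := Cset `&` Mset.

Definition r2k : poly :=
  (\sum_(i < n) (mpoly.mpolyX R (mpoly.mnm1 i)) ^+ 2) ^+ k.

(* dimension of M as an affine space: dim P_{n,2k} - 1 *)
Definition dimM : nat := 'C(n + 2 * k - 1, 2 * k) - 1.

Definition ellipsoid (c : poly) (a : 'I_dimM -> poly) : set poly :=
  [set c + \sum_(i < dimM) u i *: a i | u in [set u : 'I_dimM -> R |
     \sum_(i < dimM) u i ^+ 2 <= 1]].

Definition is_ellipsoid_param (c : poly) (a : 'I_dimM -> poly) : Prop :=
  Mset c /\ forall i, M0 (a i).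

(* volume of ellipsoid c + a(B) divided by the volume of the unit ball of
   dimension dimM: sqrt of the Gram determinant of the a_i w.r.t. <,> *)
Definition ell_volfactor (a : 'I_dimM -> poly) : R :=
  Num.sqrt (\det (\matrix_(i < dimM, j < dimM) inner (a i) (a j))).

Definition is_John_ellipsoid (K E : set poly) : Prop :=
  exists c a, [/\ is_ellipsoid_param c a, E = ellipsoid c a, E `<=` K &
    forall c' a', is_ellipsoid_param c' a' -> ellipsoid c' a' `<=` K ->
      ell_volfactor a' <= ell_volfactor a].

End Defs.

(* Main.v *)
(* The reproducing kernel of the space M0 of mean-zero forms of degree 2k is
   rotation invariant, so an orthonormal basis e of M0, with D = dim M0 elements,
   satisfies sum_i e_i(x)^2 = D on the sphere; by Cauchy-Schwarz the ball of radius
   rho = D^(-1/2) around r^(2k) consists of nonnegative forms. Conversely let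
   c + a(B) be an ellipsoid of nonnegative forms, write a_i = sum_(j <= i) L_ij e_j
   by Gram-Schmidt, so that its volume factor is prod_i L_ii, and take
   u = - rho e(x) in the unit ball B: c - rho sum_i a_i e_i is nonnegative on the
   sphere. Integrating gives sum_i L_ii <= D rho, hence prod_i L_ii <= rho^D by
   AM-GM. In the equality case this nonnegative integrand vanishes, and then
   c >= (sum_i a_i^2)^(1/2) forces a_i = rho c e_i; as L is triangular with
   diagonal rho, c = 1 on the sphere and a_i = rho e_i. *)
Require Import Defs.
From HB Require Import structures.
From mathcomp Require Import all_boot all_order all_algebra.
From mathcomp Require Import mpoly.
From mathcomp Require Import all_classical all_reals all_analysis.
From mathcomp Require Import measurable_realfun ring lra.

Import Order.TTheory GRing.Theory Num.Theory.
Import numFieldNormedType.Exports.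
Local Open Scope classical_set_scope.
Local Open Scope ring_scope.

Set Implicit Arguments.
Unset Strict Implicit.

(** * Vanishing polynomial functions *)

Local Notation widen := (widen_ord (leqnSn _)).

Lemma horner_map_muni (R : idomainType) n (p : {mpoly R[n.+1]}) (v : 'I_n.+1 -> R) :
  (map_poly (meval (fun i => v (widen i))) (muni p)).[v ord_max] = meval v p.
Proof.
rewrite muniE mevalE raddf_sum /= horner_sum; apply: eq_bigr => m _.
rewrite map_polyZ /= map_polyXn hornerZ hornerXn mevalZ mevalX -mulrA; congr (_ * _).
rewrite big_ord_recr /=; congr (_ * _).
by apply: eq_bigr => i _; rewrite mnmE.
Qed.

(** Regrouping by powers of the last variable loses no coefficient, so [p] vanishes as soon as
    [muni p] does. *)
Lemma coef_muni (R : idomainType) n (p : {mpoly R[n.+1]}) (m : 'X_{1..n.+1}) :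
  ((muni p)`_(m ord_max))@_[multinom (m (widen i)) | i < n] = p@_m.
Proof.
rewrite [p in RHS]mpolyE muniE coef_sum !raddf_sum /=; apply: eq_bigr => l _.
rewrite coefZ coefXn mcoeffZ [in RHS]mcoeffX mulr_natr mcoeffMn mcoeffZ mcoeffX.
rewrite -[in LHS]mulrnAr -mulrnA mulnb; congr (_ * (nat_of_bool _)%:R).
apply/andP/eqP => [[/eqP lm /eqP E]|->]; last by rewrite !eqxx.
apply/mnmP => i; case: (unliftP ord_max i) => [j ->|->]; last by rewrite E.
have -> : lift ord_max j = widen j by apply: val_inj; rewrite /= /bump leqNgt ltn_ord add0n.
by move/mnmP: lm => /(_ j); rewrite !mnmE.
Qed.

(** Induction on the number of variables: once the first [n] values are fixed, [p] is a univariate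
    polynomial in the last variable, with too many roots. *)
Lemma meval_eq0 (R : numDomainType) n (p : {mpoly R[n]}) :
  (forall v, meval v p = 0) -> p = 0.
Proof.
elim: n p => [|n IH] p pv0.
  rewrite [p](nvar0_mpolyC) //; move: (pv0 (fun=> 0)).
  by rewrite {1}[p]nvar0_mpolyC // mevalC => ->.
suff mp0 : muni p = 0.
  by apply/mpolyP => m; rewrite -coef_muni mp0 coef0 !mcoeff0.
apply/polyP => j; rewrite coef0; apply: IH => v.
rewrite -(coef_map (meval v)); set q := map_poly _ _.
suff -> : q = 0 by rewrite coef0.
apply/eqP; apply: contraT => q0.
(* The integers below [size q] are distinct in characteristic zero; as roots of a nonzero [q] they
   are one too many. *)
have := max_poly_roots q0 (rs := [seq i%:R | i <- iota 0 (size q)]).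
rewrite size_map size_iota ltnn; apply.
  apply/allP => _ /mapP[i _ ->]; apply/eqP.
  pose w (k : 'I_n.+1) := if unlift ord_max k is Some l then v l else i%:R.
  have := pv0 w; rewrite -horner_map_muni /w unlift_none => <-.
  congr (_.[_]); apply: eq_map_poly => r; apply: meval_eq => l.
  have -> : widen l = lift ord_max l by apply: val_inj; rewrite /= /bump leqNgt ltn_ord add0n.
  by rewrite liftK.
by rewrite map_inj_in_uniq ?iota_uniq // => a b _ _ /eqP; rewrite eqr_nat => /eqP.
Qed.

(** * Integration over the sphere *)

Section SphereIntegral.
Variables (R : realType) (n : nat).
Local Notation Rn := (Rn R n).
Implicit Types (f g : 'rV[R]_n -> R) (x y : 'rV[R]_n) (Q : 'M[R]_n).

Lemma open_measurable_Rn (A : set 'rV[R]_n) : open A -> measurable (A : set Rn).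
Proof. exact: sub_sigma_algebra. Qed.

Lemma continuous_measurable_Rn f (D : set Rn) : continuous f ->
  measurable D -> measurable_fun D (f : Rn -> R).
Proof.
move=> cf mD; apply: (@measurable_funS _ _ _ _ setT) => //.
apply: (measurability _ (RGenOpens.measurableE R)).
move=> _ [_ [a [b ->] <-]]; rewrite setTI; apply: open_measurable_Rn.
by move/continuousP: cf; apply; exact: interval_open.
Qed.

Lemma sqnormE x : sqnorm x = (x *m x^T) ord0 ord0.
Proof. by rewrite mxE; apply: eq_bigr => i _; rewrite mxE expr2. Qed.

Lemma sqnorm_ge0 x : 0 <= sqnorm x.
Proof. by apply: sumr_ge0 => i _; apply: sqr_ge0. Qed.

Lemma sqnorm_eq0 x : (sqnorm x == 0) = (x == 0).
Proof.
rewrite /sqnorm psumr_eq0; last by move=> i _; exact: sqr_ge0.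
apply/allP/eqP => [x0|-> i _]; last by rewrite mxE expr0n /= eqxx.
apply/rowP => i; rewrite mxE; apply/eqP; rewrite -sqrf_eq0; exact: (x0 i (mem_index_enum i)).
Qed.

Lemma sqnormZ a x : sqnorm (a *: x) = a ^+ 2 * sqnorm x.
Proof. by rewrite mulr_sumr; apply: eq_bigr => i _; rewrite mxE exprMn. Qed.

Lemma continuous_sqnorm : continuous (@sqnorm R n).
Proof.
rewrite /sqnorm; apply: continuous_big => [|i _ x]; first exact: add_continuous.
by apply: continuousM; apply: coord_continuous.
Qed.

Lemma closed_sphere : closed (@sphere R n : set 'rV[R]_n).
Proof.
have -> : @sphere R n = @sqnorm R n @^-1` [set 1] by apply/seteqP; split.
by move/continuous_closedP: continuous_sqnorm; apply; exact: closed_eq.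
Qed.

Lemma compact_sphere : compact (@sphere R n : set 'rV[R]_n).
Proof.
apply: bounded_closed_compact closed_sphere.
exists 1; split => // M M1 x xS; rewrite /Num.Def.normr /= mx_normrE.
apply/bigmax_leP; split => [|[i j] _ /=]; first by rewrite (le_trans ler01) ?ltW.
rewrite (le_trans _ (ltW M1))// (ord1 i) -(@ler_pXn2r _ 2) ?nnegrE// expr1n real_normK ?num_real//.
by rewrite -(xS : sqnorm x = 1) /sqnorm (bigD1 j) //= lerDl sumr_ge0 // => l _; exact: sqr_ge0.
Qed.

Lemma measurable_sphere : measurable (@sphere R n).
Proof.
rewrite -(setCK (@sphere R n)); apply: measurableC; apply: open_measurable_Rn.
exact: closed_openC closed_sphere.
Qed.

Variable sigma : probability Rn R.

Lemma integrable_sphere f : continuous f ->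
  sigma.-integrable (@sphere R n) (EFin \o (f : Rn -> R)).
Proof.
move=> cf; apply: measurable_bounded_integrable.
- exact: measurable_sphere.
- by apply: le_lt_trans (probability_le1 _ measurable_sphere) _; rewrite ltry.
- apply: continuous_measurable_Rn => //; exact: measurable_sphere.
- have cS : compact (f @` (@sphere R n : set 'rV[R]_n)).
    by apply: continuous_compact compact_sphere; exact: continuous_subspaceT.
  have [M [Mr bM]] := compact_bounded cS.
  by exists M; split => // N MN x Sx; apply: bM MN _ _; exists x.
Qed.

Lemma sintD f g : continuous f -> continuous g ->
  sint sigma (fun x => f x + g x) = sint sigma f + sint sigma g.
Proof.
by move=> cf cg; apply: RintegralD; [exact: measurable_sphere|exact: integrable_sphere..].
Qed.

Lemma sintZ a f : continuous f -> sint sigma (fun x => a * f x) = a * sint sigma f.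
Proof.
by move=> cf; apply: RintegralZl; [exact: measurable_sphere|exact: integrable_sphere].
Qed.

Lemma eq_sint f g : (forall x, sqnorm x = 1 -> f x = g x) -> sint sigma f = sint sigma g.
Proof. by move=> fg; apply: eq_Rintegral => x; rewrite inE; exact: fg. Qed.

Hypothesis sigma_rot : rot_inv_sphere_prob sigma.

Lemma sint_cst a : sint sigma (fun=> a) = a.
Proof.
rewrite /sint Rintegral_cst; last exact: measurable_sphere.
by rewrite [X in fine X](proj1 sigma_rot) mulr1.
Qed.

Lemma sqnorm_orthogonal Q x : Q *m Q^T = 1%:M -> sqnorm (x *m Q) = sqnorm x.
Proof. by move=> QQ; rewrite !sqnormE trmx_mul mulmxA -(mulmxA x) QQ mulmx1. Qed.

Lemma sqnorm_rot Q x : is_rotation Q -> sqnorm (x *m Q) = sqnorm x.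
Proof. by case=> /sqnorm_orthogonal. Qed.

Lemma continuous_mulmxr Q : continuous (fun x => x *m Q).
Proof.
under eq_fun do rewrite mulmx_sum_row.
apply: continuous_big => [|i _ x]; first exact: add_continuous.
by apply: continuousZr_tmp; exact: coord_continuous.
Qed.

(** Change of variables: the sphere is its own preimage under the rotation, and the pushforward of
    [sigma] agrees with [sigma] on measurable sets. *)
Lemma sint_rot Q f : is_rotation Q -> continuous f ->
  sint sigma (fun x => f (x *m Q)) = sint sigma f.
Proof.
move=> rQ cf; pose phi := (fun x => x *m Q) : Rn -> Rn.
have mphi : measurable_fun setT phi.
  apply: (measurability _ (erefl (@measurable _ Rn))) => _ [A oA <-]; rewrite setTI.
  apply: open_measurable_Rn.
  by move/continuousP: (@continuous_mulmxr Q); apply.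
have cfQ : continuous (fun x => f (x *m Q)).
  by move=> x; apply: continuous_comp; [exact: continuous_mulmxr|exact: cf].
have SE : phi @^-1` (@sphere R n) = @sphere R n.
  by apply/seteqP; split => x; rewrite /sphere /= sqnorm_rot.
rewrite /sint /Rintegral; congr fine.
rewrite -[in LHS]SE -(integral_pushforward mphi (f := EFin \o (f : Rn -> R))).
- apply: eq_measure_integral => A mA _; exact: (proj2 sigma_rot).
- apply/measurable_EFinP; exact: continuous_measurable_Rn.
- by rewrite SE; exact: integrable_sphere cfQ.
- exact: measurable_sphere.
Qed.
End SphereIntegral.

(** * Transitivity of the rotation group on the sphere *)

(** Sylvester's determinant identity: the products [L *m M] and [M *m L] are both block upper
    triangular, and their determinants are the two sides. *)
Lemma det_1B_mulmxC (R : comNzRingType) m n (A : 'M[R]_(m, n)) (B : 'M[R]_(n, m)) :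
  \det (1%:M - A *m B) = \det (1%:M - B *m A).
Proof.
pose M := block_mx 1%:M B A 1%:M.
pose L := block_mx 1%:M 0 (- A) 1%:M : 'M[R]_(n + m).
have detL : \det L = 1 by rewrite det_lblock !det1 mulr1.
transitivity (\det (L *m M)).
  rewrite mulmx_block !mul1mx !mul0mx !addr0 mulmx1 addNr det_ublock det1 mul1r.
  by rewrite mulNmx addrC.
rewrite !det_mulmx mulrC -det_mulmx mulmx_block !mul1mx !mulmx1 !mulmx0 addrN.
by rewrite det_ublock add0r det1 mulr1 mulmxN.
Qed.

Section Rotations.
Variables (R : realType) (n : nat).
Implicit Types (x y v : 'rV[R]_n).

(** Reflection in the hyperplane orthogonal to [v]; it is the identity at [v = 0]. *)
Definition householder v : 'M[R]_n := 1%:M - (2 / sqnorm v) *: (v^T *m v).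

Lemma mulmx_householder v x :
  x *m householder v = x - (2 * (x *m v^T) ord0 ord0 / sqnorm v) *: v.
Proof.
rewrite mulmxBr mulmx1 -scalemxAr mulmxA {1}[x *m v^T]mx11_scalar mul_scalar_mx scalerA.
by rewrite (ord1 ord0) mulrAC.
Qed.

Lemma householder_orthogonal v : householder v *m (householder v)^T = 1%:M.
Proof.
have -> : (householder v)^T = householder v.
  by rewrite /householder linearB /= trmx1 linearZ /= trmx_mul trmxK.
have [->|v0] := eqVneq v 0.
  by rewrite /householder mulmx0 scaler0 subr0 mul1mx.
have s0 : sqnorm v != 0 by rewrite sqnorm_eq0.
apply/row_matrixP => i; rewrite !rowE mulmxA mulmx1 2!mulmx_householder mulmxBl -scalemxAl.
rewrite [((_ - _) : 'M[R]_1) _ _]mxE [(- _ : 'M[R]_1) _ _]mxE [(_ *: _ : 'M[R]_1) _ _]mxE -sqnormE.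
rewrite -addrA -opprD -scalerDl [X in X *: v](_ : _ = 0) ?scale0r ?subr0 //.
by field.
Qed.

(** [det_1B_mulmxC] reduces the determinant to a 1 by 1 one, equal to [1 - 2]. *)
Lemma det_householder v : v != 0 -> \det (householder v) = -1.
Proof.
move=> v0; have s0 : sqnorm v != 0 by rewrite sqnorm_eq0.
rewrite /householder scalemxAl det_1B_mulmxC -scalemxAr det_mx11.
rewrite [((_ - _) : 'M[R]_1) _ _]mxE [(1%:M : 'M[R]_1) _ _]mxE [(- _ : 'M[R]_1) _ _]mxE.
rewrite [(_ *: _ : 'M[R]_1) _ _]mxE -(ord1 ord0) -sqnormE eqxx mulr1n.
by field.
Qed.

(** Reflecting along [x] sends [x] to [-x], and reflecting along [x + y] then sends [-x] to [y]. The
    sign alternative covers the case [y = -x], where the second reflection degenerates; it is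
    harmless for even functions. *)
Lemma rotation_transitive x y : sqnorm x = 1 -> sqnorm y = 1 ->
  exists2 Q : 'M[R]_n, is_rotation Q & x *m Q = y \/ x *m Q = - y.
Proof.
move=> x1 y1; have [xy0|xy0] := eqVneq (x + y) 0.
  exists 1%:M; first by split; rewrite ?det1 // trmx1 mulmx1.
  by right; rewrite mulmx1; apply/eqP; rewrite -addr_eq0 xy0.
have x0 : x != 0 by rewrite -sqnorm_eq0 x1 oner_eq0.
exists (householder x *m householder (x + y)); first split.
- by rewrite trmx_mul mulmxA -(mulmxA (householder x)) householder_orthogonal mulmx1
    householder_orthogonal.
- by rewrite det_mulmx !det_householder // mulrNN mulr1.
left.
rewrite mulmxA (mulmx_householder x x) -sqnormE x1 divr1 mulr1.
rewrite -[X in X - _]scale1r -scalerBl (_ : 1 - 2 = -1 :> R) ?scaleN1r; last by ring.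
rewrite mulNmx mulmx_householder.
(* Both vectors being unit, this makes the coefficient of [x + y] in the reflection equal to 1. *)
have E : sqnorm (x + y) = 2 * (x *m (x + y)^T) ord0 ord0.
  rewrite linearD mulmxDr /= mxE -sqnormE x1.
  rewrite sqnormE linearD /= mulmxDr !mulmxDl !mxE.
  have := sqnormE x; have := sqnormE y; rewrite x1 y1 !mxE => <- <-.
  have -> : \sum_j y ord0 j * x^T j ord0 = \sum_j x ord0 j * y^T j ord0.
    by apply: eq_bigr => j _; rewrite !mxE mulrC.
  by ring.
by rewrite -E divff ?sqnorm_eq0 // scale1r opprB addrAC subrr add0r.
Qed.
End Rotations.

(** * Definiteness of the integral on forms *)

Section SphereIntegralPositive.
Variables (R : realType) (n : nat) (sigma : probability (Rn R n) R).
Implicit Types (f g : 'rV[R]_n -> R) (x y : 'rV[R]_n).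

Lemma continuous_sum I (r : seq I) (F : I -> 'rV[R]_n -> R) :
  (forall i, continuous (F i)) -> continuous (fun x => \sum_(i <- r) F i x).
Proof.
by move=> cF; apply: continuous_big => [|i _]; [exact: add_continuous|exact: cF].
Qed.

Hypothesis sigma_rot : rot_inv_sphere_prob sigma.

Lemma le_sint f g : continuous f -> continuous g ->
  (forall x, sqnorm x = 1 -> f x <= g x) -> sint sigma f <= sint sigma g.
Proof.
move=> cf cg fg; apply: le_Rintegral => //.
- exact: measurable_sphere.
- exact: integrable_sphere.
- exact: integrable_sphere.
Qed.

Lemma sint_sum I (r : seq I) (F : I -> 'rV[R]_n -> R) :
  (forall i, continuous (F i)) ->
  sint sigma (fun x => \sum_(i <- r) F i x) = \sum_(i <- r) sint sigma (F i).
Proof.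
move=> cF; elim: r => [|i r IH].
  by under eq_fun do rewrite big_nil; rewrite big_nil sint_cst.
under eq_fun do rewrite big_cons.
by rewrite big_cons sintD ?IH //; exact: continuous_sum.
Qed.

(* Were f x > 0, finitely many rotated copies of the set where f > f x / 2 would,
   up to sign, cover the sphere, and the corresponding sum of rotated copies of f,
   whose integral is 0, would be bounded below by f x / 2. *)
Lemma sint_eq0 f : continuous f -> (forall x, f (- x) = f x) ->
  (forall x, sqnorm x = 1 -> 0 <= f x) -> sint sigma f = 0 ->
  forall x, sqnorm x = 1 -> f x = 0.
Proof.
move=> cf fN f0 If x x1; apply/eqP; rewrite eq_le f0 // andbT leNgt; apply/negP => fx.
pose U := [set y : 'rV[R]_n | f x / 2 < f y].
have oU : open U.
  have -> : U = f @^-1` [set r | f x / 2 < r] by [].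
  by move/continuousP: cf; apply; exact: open_gt.
have := @compact_sphere R n; rewrite compact_cover.
move=> /(_ _ [set Q : 'M[R]_n | is_rotation Q] (fun Q => [set y | U (y *m Q)])) [].
- move=> Q _; have -> : [set y | U (y *m Q)] = (fun y => y *m Q) @^-1` U by [].
  by move/continuousP: (@continuous_mulmxr R n Q); apply.
- move=> y y1; have [Q rQ yQ] := rotation_transitive (y1 : sqnorm y = 1) x1.
  exists Q => //=; rewrite /U /=; have -> : f (y *m Q) = f x by case: yQ => ->.
  by lra.
move=> E ED cov; pose s : seq 'M[R]_n := finmap.enum_fset E.
have sD Q : Q \in s -> is_rotation Q by move/ED; rewrite inE.
have cfQ Q : continuous (fun y => f (y *m Q)).
  by move=> y; apply: continuous_comp; [exact: continuous_mulmxr|exact: cf].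
have : sint sigma (fun=> f x / 2) <= sint sigma (fun y => \sum_(Q <- s) f (y *m Q)).
  apply: le_sint => [||y y1]; first by move=> z; apply: cst_continuous.
    exact: continuous_sum.
  have [Q /= QE UQ] := cov y y1.
  apply: le_trans (ltW UQ) _; rewrite (big_rem Q) //= lerDl.
  rewrite big_seq sumr_ge0 // => P PE; apply: f0; rewrite sqnorm_rot //.
  exact: sD (mem_rem PE).
rewrite sint_cst // sint_sum // big_seq big1 => [|Q QE]; first by lra.
by rewrite sint_rot //; exact: sD.
Qed.

End SphereIntegralPositive.

(** * Forms as homogeneous functions, determined by their values on the sphere *)

Section Forms.
Variables (R : realType) (n : nat).
Implicit Types (p q : {mpoly R[n]}) (x : 'rV[R]_n).

Lemma evD p q x : ev (p + q) x = ev p x + ev q x. Proof. exact: mevalD. Qed.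
Lemma evB p q x : ev (p - q) x = ev p x - ev q x. Proof. exact: mevalB. Qed.
Lemma evZ a p x : ev (a *: p) x = a * ev p x. Proof. exact: mevalZ. Qed.
Lemma evM p q x : ev (p * q) x = ev p x * ev q x. Proof. exact: mevalM. Qed.
Lemma ev_sum I (r : seq I) (P : pred I) (F : I -> {mpoly R[n]}) x :
  ev (\sum_(i <- r | P i) F i) x = \sum_(i <- r | P i) ev (F i) x.
Proof. exact: raddf_sum. Qed.

Lemma continuous_ev p : continuous (ev p).
Proof.
have -> : ev p = fun x => \sum_(m <- msupp p) p@_m * \prod_i x ord0 i ^+ m i.
  by apply/funext => x; rewrite /ev mevalE.
apply: continuous_sum => m x; apply: continuousM; first exact: cst_continuous.
apply: continuous_big => [|i _ {}x]; first exact: mul_continuous.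
apply: (@continuous_comp _ _ _ (fun x : 'rV[R]_n => x ord0 i) (fun r : R => r ^+ m i)).
  exact: coord_continuous.
exact: exprn_continuous.
Qed.

Lemma ev_form_scale d p a x : is_form d p -> ev p (a *: x) = a ^+ d * ev p x.
Proof.
move=> /dhomogP hp; rewrite /ev !mevalE mulr_sumr big_seq [RHS]big_seq.
apply: eq_bigr => m mp; have <- : mdeg m = d := hp m mp; rewrite mulrCA; congr (_ * _).
rewrite mdegE -prodrXr -big_split /=; apply: eq_bigr => i _.
by rewrite mxE exprMn.
Qed.

Lemma ev_formN k p x : is_form (2 * k) p -> ev p (- x) = ev p x.
Proof.
move=> hp; rewrite -scaleN1r (ev_form_scale _ _ hp) exprM sqrrN expr1n expr1n.
by rewrite mul1r.
Qed.

Lemma ev_form_sphere d p x : is_form d p -> x != 0 ->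
  exists2 y, sqnorm y = 1 & ev p x = Num.sqrt (sqnorm x) ^+ d * ev p y.
Proof.
move=> hp x0; have s0 : 0 < sqnorm x by rewrite lt_neqAle sqnorm_ge0 eq_sym sqnorm_eq0 x0.
exists ((Num.sqrt (sqnorm x))^-1 *: x).
  by rewrite sqnormZ exprVn sqr_sqrtr ?ltW // mulVf // lt0r_neq0.
by rewrite -(ev_form_scale _ _ hp) scalerA mulfV ?scale1r // lt0r_neq0 // sqrtr_gt0.
Qed.

Lemma ev_form0 d p : (0 < d)%N -> is_form d p -> ev p 0 = 0.
Proof.
by move=> d0 hp; rewrite -(scale0r (0 : 'rV[R]_n)) (ev_form_scale _ _ hp) expr0n eqn0Ngt d0 mul0r.
Qed.

(** Homogeneity spreads the vanishing to every nonzero vector, positive degree gives it at the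
    origin, and [meval_eq0] concludes. *)
Lemma form_sphere_eq0 d p : (0 < d)%N -> is_form d p ->
  (forall x, sqnorm x = 1 -> ev p x = 0) -> p = 0.
Proof.
move=> d0 hp p0; apply: meval_eq0 => v.
have -> : meval v p = ev p (\row_i v i) by apply: meval_eq => i; rewrite mxE.
have [->|/(ev_form_sphere hp)[y y1 ->]] := eqVneq (\row_i v i) 0; first exact: ev_form0 hp.
by rewrite p0 ?mulr0.
Qed.

Lemma ev_r2k k x : ev (r2k R n k) x = sqnorm x ^+ k.
Proof.
rewrite /ev /r2k rmorphXn rmorph_sum /=; congr (_ ^+ _); apply: eq_bigr => i _.
by rewrite rmorphXn /= mevalXU.
Qed.

Lemma is_form_r2k k : is_form (2 * k) (r2k R n k).
Proof.
apply: dhomogMn; apply: rpred_sum => i _.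
apply: (@dhomogMn _ _ _ 1); rewrite dhomogX; exact/eqP/mdeg1.
Qed.

End Forms.

(** * Cholesky factorisation *)

(** Induction splitting off the first row and column: positive definiteness passes to the Schur
    complement [S] of the corner entry [a]. *)
Lemma cholesky (R : rcfType) m (G : 'M[R]_m) : G^T = G ->
  (forall u : 'rV[R]_m, u != 0 -> 0 < (u *m G *m u^T) 0 0) ->
  exists L : 'M[R]_m, [/\ is_trig_mx L, forall i, 0 < L i i & G = L *m L^T].
Proof.
elim: m G => [|m IH] G Gsym Gpos.
  exists 0; split => [|i|]; [by apply/is_trig_mxP => [[]]|by case: i|].
  by apply/matrixP => [[]].
move: (G : 'M[R]_(1 + m)) Gsym Gpos => {}G Gsym Gpos0.
have Gpos (u : 'rV[R]_(1 + m)) : u != 0 -> 0 < (u *m G *m u^T) 0 0 := Gpos0 u.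
pose a := ulsubmx G 0 0; pose v : 'rV[R]_m := ursubmx G.
have GE : G = block_mx a%:M v v^T (drsubmx G).
  by rewrite -mx11_scalar /v trmx_ursub Gsym submxK.
have a0 : 0 < a.
  have /Gpos : row_mx (1%:M : 'M[R]_1) (0 : 'rV[R]_m) != 0.
    rewrite -row_mx0; apply/eqP => /eq_row_mx[/matrixP/(_ 0 0) + _].
    by rewrite !mxE => /eqP; rewrite oner_eq0.
  rewrite [in X in X -> _]GE mul_row_block !mul1mx !mul0mx !addr0 tr_row_mx mul_row_col.
  by rewrite trmx1 trmx0 mulmx1 mulmx0 addr0 mxE eqxx mulr1n.
have Gd : (drsubmx G)^T = drsubmx G by rewrite trmx_drsub Gsym.
pose S := drsubmx G - a^-1 *: (v^T *m v).
have [|u u0|L1 [trigL1 L1pos SE]] := IH S.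
- by rewrite /S linearB /= linearZ /= trmx_mul trmxK Gd.
(* This [t] kills the first entry of [(t, u) G], so the quadratic form of [G] at [(t, u)] is that of
   [S] at [u]. *)
- pose t := - (u *m v^T) 0 0 / a.
  have /Gpos : row_mx t%:M u != 0.
    by rewrite -row_mx0; apply: contra u0 => /eqP/eq_row_mx[_ ->].
  rewrite [in X in X -> _]GE mul_row_block tr_row_mx mul_row_col.
  rewrite (_ : t%:M *m a%:M + u *m v^T = 0); last first.
    rewrite [u *m v^T]mx11_scalar -scalar_mxM -raddfD /= /t mulfVK ?lt0r_neq0 //.
    by rewrite addNr raddf0.
  rewrite mul0mx add0r (_ : t%:M *m v + u *m drsubmx G = u *m S) //.
  rewrite /S mulmxBr addrC -scalemxAr mulmxA
    [in RHS](mx11_scalar (u *m v^T)) !mul_scalar_mx scalerA.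
  by congr (_ + _); rewrite -scaleNr /t mulNr mulrC.
have sa : 0 < Num.sqrt a by rewrite sqrtr_gt0.
have sa2 : Num.sqrt a * Num.sqrt a = a by rewrite -expr2 sqr_sqrtr // ltW.
pose L : 'M[R]_(1 + m) := block_mx (Num.sqrt a)%:M 0 ((Num.sqrt a)^-1 *: v^T) L1.
have trigL : is_trig_mx L by rewrite is_trig_block_mx // eqxx trigL1 mx11_is_trig.
have Lpos (i : 'I_(1 + m)) : 0 < L i i.
  by case: (split_ordP i) => j ->; rewrite ?block_mxEul ?block_mxEdr // mxE (ord1 j) eqxx mulr1n.
suff GL : G = L *m L^T by exists L.
rewrite /L tr_block_mx mulmx_block trmx0 !mulmx0 !mul0mx !addr0 linearZ /= trmxK.
rewrite tr_scalar_mx -scalar_mxM sa2 {1}GE -[drsubmx G](subrK (a^-1 *: (v^T *m v))) -/S SE.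
congr block_mx.
- by rewrite mul_scalar_mx scalerA mulfV ?scale1r // lt0r_neq0.
- by rewrite mul_mx_scalar scalerA mulfV ?scale1r // lt0r_neq0.
- by rewrite -scalemxAl -scalemxAr scalerA -invfM sa2 addrC.
Qed.

(** * Gram matrices of forms *)

Section InnerProduct.
Variables (R : realType) (n : nat) (sigma : probability (Rn R n) R).
Implicit Types (p q : {mpoly R[n]}) (x : 'rV[R]_n).
Local Notation "<< p , q >>" := (inner sigma p q).

Definition lincomb m l (A : 'M[R]_(m, l)) (a : 'I_l -> {mpoly R[n]}) (i : 'I_m) : {mpoly R[n]} :=
  \sum_j A i j *: a j.

Definition gram m l (a : 'I_m -> {mpoly R[n]}) (b : 'I_l -> {mpoly R[n]}) : 'M[R]_(m, l) :=
  \matrix_(i, j) << a i, b j >>.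

Lemma lincombM m l r (A : 'M[R]_(m, l)) (B : 'M[R]_(l, r)) a i :
  lincomb A (lincomb B a) i = lincomb (A *m B) a i.
Proof.
rewrite /lincomb; under eq_bigr do rewrite scaler_sumr.
rewrite exchange_big; apply: eq_bigr => j _; rewrite mxE scaler_suml.
by apply: eq_bigr => l' _; rewrite scalerA.
Qed.

Lemma lincomb1 m (a : 'I_m -> {mpoly R[n]}) i : lincomb 1%:M a i = a i.
Proof.
rewrite /lincomb (bigD1 i) //= mxE eqxx scale1r big1 ?addr0 // => j /negbTE ji.
by rewrite mxE eq_sym ji scale0r.
Qed.

Lemma ev_lincomb m l (A : 'M[R]_(m, l)) a i x :
  ev (lincomb A a i) x = \sum_j A i j * ev (a j) x.
Proof. by rewrite ev_sum; apply: eq_bigr => j _; rewrite evZ. Qed.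

Lemma is_form_lincomb d m l (A : 'M[R]_(m, l)) (a : 'I_l -> {mpoly R[n]}) i :
  (forall j, is_form d (a j)) -> is_form d (lincomb A a i).
Proof. by move=> ha; apply: rpred_sum => j _; apply: rpredZ; exact: ha. Qed.

Lemma continuous_evM p q : continuous (fun x => ev p x * ev q x).
Proof. by move=> x; apply: continuousM; exact: continuous_ev. Qed.

Lemma innerC p q : <<p, q>> = <<q, p>>.
Proof. by apply: eq_sint => x _; rewrite mulrC. Qed.

Hypothesis sigma_rot : rot_inv_sphere_prob sigma.

Lemma sint_ev_sum I (r : seq I) (c : I -> R) (F : I -> {mpoly R[n]}) :
  sint sigma (ev (\sum_(i <- r) c i *: F i)) = \sum_(i <- r) c i * sint sigma (ev (F i)).
Proof.
have -> : ev (\sum_(i <- r) c i *: F i) = fun x => \sum_(i <- r) c i * ev (F i) x.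
  by apply/funext => x; rewrite ev_sum; apply: eq_bigr => i _; rewrite evZ.
rewrite sint_sum // => [|i x]; last first.
  by apply: continuousM; [exact: cst_continuous|exact: continuous_ev].
by apply: eq_bigr => i _; rewrite sintZ //; exact: continuous_ev.
Qed.

Lemma sint_evD p q : sint sigma (ev (p + q)) = sint sigma (ev p) + sint sigma (ev q).
Proof.
have := sint_ev_sum [:: p; q] (fun=> 1) id.
by rewrite !big_cons !big_nil !scale1r !mul1r !addr0.
Qed.

Lemma sint_evZ c p : sint sigma (ev (c *: p)) = c * sint sigma (ev p).
Proof.
have := sint_ev_sum [:: p] (fun=> c) id.
by rewrite !big_cons !big_nil !addr0.
Qed.

Lemma inner_suml I (r : seq I) (c : I -> R) (F : I -> {mpoly R[n]}) q :
  << \sum_(i <- r) c i *: F i, q >> = \sum_(i <- r) c i * << F i, q >>.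
Proof.
have innerE p : <<p, q>> = sint sigma (ev (p * q)) by apply: eq_sint => x _; rewrite evM.
rewrite innerE mulr_suml; under eq_bigr do rewrite -scalerAl.
by rewrite sint_ev_sum; apply: eq_bigr => i _; rewrite innerE.
Qed.

Lemma innerZl c p q : << c *: p, q >> = c * << p, q >>.
Proof.
have := inner_suml [:: p] (fun=> c) id q.
by rewrite !big_cons !big_nil !addr0.
Qed.

Lemma gram_lincomb m l r s (A : 'M[R]_(m, l)) (B : 'M[R]_(r, s)) a b :
  gram (lincomb A a) (lincomb B b) = A *m gram a b *m B^T.
Proof.
apply/matrixP => i j; rewrite !mxE inner_suml.
under [RHS]eq_bigr do rewrite !mxE mulr_suml.
rewrite exchange_big; apply: eq_bigr => k _.
rewrite innerC inner_suml mulr_sumr; apply: eq_bigr => t _.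
by rewrite !mxE innerC mulrCA mulrC.
Qed.

Lemma tr_gram m (a : 'I_m -> {mpoly R[n]}) : (gram a a)^T = gram a a.
Proof. by apply/matrixP => i j; rewrite !mxE innerC. Qed.

Variable k : nat.
Hypothesis k_gt0 : (0 < k)%N.

Lemma inner_ge0 p : 0 <= <<p, p>>.
Proof. by apply: Rintegral_ge0 => x _; rewrite -expr2 sqr_ge0. Qed.

(** The square of [p] is even, continuous and nonnegative with zero integral, so [p] vanishes on the
    sphere. *)
Lemma inner_eq0 p : is_form (2 * k) p -> <<p, p>> = 0 -> p = 0.
Proof.
move=> hp p0; apply: (form_sphere_eq0 _ hp); first by rewrite muln_gt0.
move=> x x1; apply/eqP; rewrite -sqrf_eq0 expr2; apply/eqP.
apply: (sint_eq0 sigma_rot (f := fun x => ev p x * ev p x)) x x1 => //.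
- exact: continuous_evM.
- by move=> x; rewrite (ev_formN _ hp).
- by move=> x _; rewrite -expr2 sqr_ge0.
Qed.

(* Gram-Schmidt: the Cholesky factor of the Gram matrix expresses a in an
   orthonormal family adapted to it. *)
Lemma gram_schmidt m (a : 'I_m -> {mpoly R[n]}) :
  (forall i, is_form (2 * k) (a i)) -> \det (gram a a) != 0 ->
  exists L : 'M[R]_m, [/\ is_trig_mx L, forall i, 0 < L i i, gram a a = L *m L^T,
    gram (lincomb (invmx L) a) (lincomb (invmx L) a) = 1%:M &
    forall i, a i = lincomb L (lincomb (invmx L) a) i].
Proof.
move=> ha Gdet.
have [|u u0|L [trigL Lpos GL]] := @cholesky R m (gram a a); first exact: tr_gram.
  pose U (i : 'I_1) := lincomb u a i.
  have E : (u *m gram a a *m u^T) 0 0 = << U 0, U 0 >> by rewrite -gram_lincomb mxE.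
  rewrite E lt_neqAle inner_ge0 andbT eq_sym; apply/eqP => U0.
  have {}U0 : U 0 = 0 by apply: inner_eq0 => //; exact: is_form_lincomb.
  case/det0P: Gdet; exists u => //.
  rewrite -[gram a a]mulmx1 -trmx1 mulmxA -gram_lincomb; apply/matrixP => i j.
  by rewrite !mxE (ord1 i) -/(U 0) U0 -(scale0r 0) innerZl mul0r.
have Lu : L \in unitmx.
  by rewrite unitmxE unitfE det_trig // prodf_seq_neq0; apply/allP => i _; rewrite lt0r_neq0.
exists L; split => // [|i].
  by rewrite gram_lincomb GL mulmxA mulVmx // mul1mx -trmx_mul mulVmx // trmx1.
by rewrite lincombM mulmxV // lincomb1.
Qed.

End InnerProduct.

(** * Orthonormal bases of mean-zero forms *)

Section OrthonormalBases.
Variables (R : realType) (n : nat) (sigma : probability (Rn R n) R) (k : nat).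
Hypotheses (n_gt0 : (0 < n)%N) (k_gt0 : (0 < k)%N) (sigma_rot : rot_inv_sphere_prob sigma).
Implicit Types (p q f : {mpoly R[n]}) (x y : 'rV[R]_n) (Q : 'M[R]_n).
Local Notation "<< p , q >>" := (inner sigma p q).
Local Notation N := 'C(n + 2 * k - 1, 2 * k).
Local Notation D := (dimM n k).

(** The prescribed length is the dimension of the space of forms of degree [d], so a free family of
    that length spans it. *)
Lemma form_coordinates d m (b : 'I_m -> {mpoly R[n]}) : m = 'C(n + d - 1, d) ->
  (forall i, is_form d (b i)) ->
  (forall c : 'I_m -> R, \sum_i c i *: b i = 0 -> forall i, c i = 0) ->
  forall f, is_form d f -> exists c : 'I_m -> R, f = \sum_i c i *: b i.
Proof.
move: n_gt0 b => /prednK <-; move: n.-1 => n' b mE hb free_b f hf.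
pose X := [tuple DHomog (hb i) | i < m].
have XE (i : 'I_m) : X`_i = DHomog (hb i) by rewrite -tnth_nth tnth_mktuple.
have freeX : free X.
  apply/freeP => c c0 i; apply: free_b i.
  move: c0 => /(congr1 (@mpoly_of_dhomog _ _ _)); rewrite linear_sum linear0 => c0.
  rewrite -[RHS]c0.
  by apply: eq_bigr => j _; rewrite linearZ XE.
have spanX : <<X>>%VS = fullv.
  apply/eqP; rewrite eqEdim subvf dimvf (eqP freeX) size_tuple mE.
  by rewrite /dim /= addSn subn1 addnC.
have := memvf (DHomog hf); rewrite -spanX => /coord_span fE.
exists (fun i => coord X i (DHomog hf)).
move: fE => /(congr1 (@mpoly_of_dhomog _ _ _)); rewrite linear_sum => /= {1}->.
by apply: eq_bigr => j _; rewrite XE.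
Qed.

Lemma form_basis d m : m = 'C(n + d - 1, d) -> exists b : 'I_m -> {mpoly R[n]},
  (forall i, is_form d (b i)) /\
  (forall c : 'I_m -> R, \sum_i c i *: b i = 0 -> forall i, c i = 0).
Proof.
move: n_gt0 => /prednK <-; move: n.-1 => n' mE.
have mD : m = \dim (fullv : {vspace dhomog n'.+1 R d}).
  by rewrite dimvf mE /dim /= addSn subn1 addnC.
move: mE; rewrite {m}mD => _.
pose X := vbasis (fullv : {vspace dhomog n'.+1 R d}).
exists (fun i => mpoly_of_dhomog X`_i); split => [i|c c0]; first exact: dhomog_is_dhomog.
have /freeP := basis_free (vbasisP (fullv : {vspace dhomog n'.+1 R d})); apply.
apply: val_inj => /=; rewrite linear_sum /= -[RHS]c0.
exact: eq_bigr.
Qed.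

Lemma gram1P m (e : 'I_m -> {mpoly R[n]}) : gram sigma e e = 1%:M ->
  forall i j, << e i, e j >> = (i == j)%:R.
Proof. by move=> e1 i j; have /matrixP/(_ i j) := e1; rewrite !mxE. Qed.

Lemma orthonormal_expansion m (e : 'I_m -> {mpoly R[n]}) (c : 'I_m -> R) i :
  gram sigma e e = 1%:M -> << \sum_j c j *: e j, e i >> = c i.
Proof.
move=> /gram1P e1; rewrite inner_suml // (bigD1 i) //= e1 eqxx mulr1 big1 ?addr0 //.
by move=> j /negbTE ji; rewrite e1 ji mulr0.
Qed.

(** Orthonormality gives linear independence, the length gives spanning, and inner products with the
    [e i] read off the coordinates. *)
Lemma orthonormal_complete m (e : 'I_m -> {mpoly R[n]}) : m = N ->
  (forall i, is_form (2 * k) (e i)) -> gram sigma e e = 1%:M ->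
  forall f, is_form (2 * k) f -> f = \sum_i << f, e i >> *: e i.
Proof.
move=> mN he e1 f hf.
have [c c0 i|c fE] := form_coordinates mN he _ hf.
  by rewrite -(orthonormal_expansion c i e1) c0 -(scale0r 0) innerZl // mul0r.
rewrite {1}fE; apply: eq_bigr => i _; congr (_ *: _).
by rewrite fE orthonormal_expansion.
Qed.

(** On the sphere [r2k] is constantly 1. Among forms of degree [2 * k], mean zero therefore means
    orthogonal to [r2k]. *)
Lemma inner_r2k f : is_form (2 * k) f -> << f, r2k R n k >> = sint sigma (ev f).
Proof. by move=> hf; apply: eq_sint => x x1; rewrite ev_r2k x1 expr1n mulr1. Qed.

Lemma sint_r2k : sint sigma (ev (r2k R n k)) = 1.
Proof.
rewrite -(sint_cst sigma_rot 1); apply: eq_sint => x x1.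
by rewrite ev_r2k x1 expr1n.
Qed.

(** The binomial coefficient is positive, so the truncated subtraction in [dimM] is exact. *)
Lemma dimM_succ : D.+1 = N.
Proof.
rewrite /dimM subn1 prednK // bin_gt0.
by case: n n_gt0 => // m _; rewrite addSn subn1 leq_addl.
Qed.

(** Adding the unit vector [r2k] at index 0 turns an orthonormal family of [D] mean-zero forms into
    an orthonormal basis of all forms of degree [2 * k]. *)
Definition adjoin_r2k (e : 'I_D -> {mpoly R[n]}) (i : 'I_D.+1) : {mpoly R[n]} :=
  if unlift ord0 i is Some j then e j else r2k R n k.

Lemma orthonormal_M0_complete (e : 'I_D -> {mpoly R[n]}) :
  (forall i, M0 sigma k (e i)) -> gram sigma e e = 1%:M ->
  forall f, M0 sigma k f -> f = \sum_i << f, e i >> *: e i.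
Proof.
move=> he e1 f [hf f0].
have hb i : is_form (2 * k) (adjoin_r2k e i).
  by rewrite /adjoin_r2k; case: unliftP => [j _|_]; [case: (he j)|exact: is_form_r2k].
have b1 : gram sigma (adjoin_r2k e) (adjoin_r2k e) = 1%:M.
  apply/matrixP => i j; rewrite !mxE /adjoin_r2k.
  case: unliftP => [i' ->|->]; case: unliftP => [j' ->|->].
  - by rewrite (gram1P e1) (inj_eq lift_inj).
  - by have [hi i0] := he i'; rewrite inner_r2k // i0.
  - by have [hj j0] := he j'; rewrite innerC inner_r2k // j0.
  - by rewrite inner_r2k ?sint_r2k ?eqxx //; exact: is_form_r2k.
rewrite {1}(orthonormal_complete dimM_succ hb b1 hf) big_ord_recl.
rewrite {1 2}/adjoin_r2k unlift_none inner_r2k // f0 scale0r add0r.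
by apply: eq_bigr => i _; rewrite /adjoin_r2k liftK.
Qed.

(** An orthonormal basis of all forms is turned by an orthogonal matrix until its first member is
    [r2k] up to sign; the others are then orthogonal to [r2k], that is, of mean zero. *)
Lemma exists_orthonormal_M0 : exists e : 'I_D -> {mpoly R[n]},
  (forall i, M0 sigma k (e i)) /\ gram sigma e e = 1%:M.
Proof.
have [b [hb free_b]] := form_basis dimM_succ.
have [|L [_ _ _ h1 _]] := gram_schmidt sigma_rot k_gt0 hb.
  apply/negP => /det0P[u u0 uG]; case/eqP: u0; apply/rowP => i; rewrite [RHS]mxE.
  apply: free_b i; apply: (inner_eq0 sigma_rot k_gt0).
    by apply: rpred_sum => j _; apply: rpredZ; exact: hb.
  have := congr1 (fun A : 'rV_D.+1 => (A *m u^T) 0 0) uG.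
  rewrite -(gram_lincomb sigma_rot u u) mul0mx !mxE; exact.
set h := lincomb _ _ in h1.
have hh i : is_form (2 * k) (h i) by exact: is_form_lincomb.
(* The coordinates [w] of [r2k] form a unit vector; a rotation takes the first basis vector to [w]
   or [-w], which is thus the first row of [Q]. *)
pose w : 'rV[R]_D.+1 := \row_i << r2k R n k, h i >>.
have wE : r2k R n k = \sum_i w ord0 i *: h i.
  rewrite {1}(orthonormal_complete dimM_succ hh h1 (is_form_r2k R n k)).
  by apply: eq_bigr => i _; rewrite mxE.
have w1 : sqnorm w = 1.
  rewrite -sint_r2k -(inner_r2k (is_form_r2k R n k)) {1}wE inner_suml //.
  by apply: eq_bigr => i _; rewrite innerC mxE expr2.
have d1 : sqnorm (delta_mx ord0 ord0 : 'rV[R]_D.+1) = 1.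
  rewrite /sqnorm big_ord_recl big1 => [|i _]; rewrite !mxE ?eqxx ?addr0 ?expr1n //.
  by rewrite expr0n.
have [Q [QQ _] Qw] := rotation_transitive d1 w1.
have Q0 : lincomb Q h ord0 = r2k R n k \/ lincomb Q h ord0 = - r2k R n k.
  have Q0j j : Q ord0 j = ((delta_mx ord0 ord0 : 'rV[R]_D.+1) *m Q) ord0 j.
    by rewrite (ord1 ord0) -rowE mxE.
  case: Qw => Qw; [left|right]; rewrite /lincomb wE -?sumrN; apply: eq_bigr => j _.
    by rewrite Q0j Qw.
  by rewrite Q0j Qw [(- w) _ _]mxE scaleNr.
have g1 : gram sigma (lincomb Q h) (lincomb Q h) = 1%:M.
  by rewrite gram_lincomb // h1 mulmx1 QQ.
exists (fun i => lincomb Q h (lift ord0 i)); split => [i|].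
  have hi : is_form (2 * k) (lincomb Q h (lift ord0 i)) by exact: is_form_lincomb.
  split => //; rewrite -inner_r2k //.
  have := gram1P g1 (lift ord0 i) ord0.
  case: Q0 => ->; first by move=> ->.
  by rewrite -scaleN1r innerC innerZl // innerC => /eqP; rewrite mulN1r oppr_eq0 => /eqP ->.
by apply/matrixP => i j; rewrite !mxE (gram1P g1) (inj_eq lift_inj).
Qed.

(** * The action of rotations on forms by substitution *)

Definition rotate Q p : {mpoly R[n]} := p \mPo [tuple \sum_j Q j i *: 'X_j | i < n].

Lemma ev_rotate Q p x : ev (rotate Q p) x = ev p (x *m Q).
Proof.
rewrite /ev /rotate comp_mpoly_meval; apply: meval_eq => i.
rewrite tnth_mktuple raddf_sum mxE; apply: eq_bigr => j _ /=.
by rewrite mevalZ mevalXU mulrC.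
Qed.

Lemma is_form_rotate d Q p : is_form d p -> is_form d (rotate Q p).
Proof.
move=> /dhomogP hp; rewrite /rotate comp_mpolyE /is_form big_seq; apply: rpred_sum => m mp.
apply: rpredZ; have <- : mdeg m = d := hp m mp.
rewrite mdegE; apply: (big_ind2 (fun (q : {mpoly R[n]}) d => q \is d.-homog for mdeg)).
- exact: dhomog1.
- by move=> ? ? ? ?; exact: dhomogM.
move=> i _; rewrite tnth_mktuple -[X in X.-homog for _]mul1n; apply: dhomogMn.
by apply: rpred_sum => j _; apply: rpredZ; rewrite dhomogX; exact/eqP/mdeg1.
Qed.

Lemma sint_rotate Q p : is_rotation Q -> sint sigma (ev (rotate Q p)) = sint sigma (ev p).
Proof.
move=> rQ; rewrite -(sint_rot sigma_rot rQ (@continuous_ev R n p)).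
by apply: eq_sint => x _; rewrite ev_rotate.
Qed.

Lemma inner_rotate Q p q : is_rotation Q -> << rotate Q p, rotate Q q >> = << p, q >>.
Proof.
move=> rQ; rewrite /inner -(sint_rot sigma_rot rQ (@continuous_evM R n p q)).
by apply: eq_sint => x _; rewrite !ev_rotate.
Qed.

(* Rotating an orthonormal basis of M0 changes it by an orthogonal matrix, so the
   sum of squares is rotation invariant, hence constant on the sphere. *)
Lemma sum_sqr_orthonormal_M0 (e : 'I_D -> {mpoly R[n]}) :
  (forall i, M0 sigma k (e i)) -> gram sigma e e = 1%:M ->
  forall x, sqnorm x = 1 -> \sum_i ev (e i) x ^+ 2 = D%:R.
Proof.
move=> he e1.
pose E x : 'rV[R]_D := \row_i ev (e i) x.
have EE x : \sum_i ev (e i) x ^+ 2 = sqnorm (E x).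
  by apply: eq_bigr => i _; rewrite mxE.
have Erot Q x : is_rotation Q -> sqnorm (E (x *m Q)) = sqnorm (E x).
  move=> rQ; pose U := gram sigma (fun i => rotate Q (e i)) e.
  have UE i : rotate Q (e i) = lincomb U e i.
    rewrite {1}(orthonormal_M0_complete he e1 (f := rotate Q (e i))).
      by apply: eq_bigr => j _; rewrite mxE.
    by have [hi i0] := he i; split; [exact: is_form_rotate|rewrite sint_rotate].
  have UU : U *m U^T = 1%:M.
    rewrite (_ : _ *m _ = gram sigma (lincomb U e) (lincomb U e)) -?e1.
      by apply/matrixP => i j; rewrite !mxE -!UE inner_rotate.
    by rewrite gram_lincomb // e1 mulmx1.
  rewrite -(sqnorm_orthogonal (Q := U^T) (E x)); last by rewrite trmxK; apply: mulmx1C.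
  congr sqnorm; apply/rowP => i; rewrite !mxE -ev_rotate UE ev_lincomb.
  by apply: eq_bigr => j _; rewrite !mxE mulrC.
move=> x x1; have Ec y : sqnorm y = 1 -> sqnorm (E y) = sqnorm (E x).
  move=> y1; have [Q rQ xQ] := rotation_transitive x1 y1.
  rewrite -(Erot Q x rQ); case: xQ => -> //; congr sqnorm.
  by apply/rowP => i; rewrite !mxE (ev_formN _ (proj1 (he i))).
(* The constant is its own mean, computed term by term: each [e i] has norm 1, and there are [D] of
   them. *)
rewrite EE -(sint_cst sigma_rot (sqnorm (E x))).
have <- : sint sigma (fun y => \sum_i ev (e i) y * ev (e i) y) = sint sigma (fun=> sqnorm (E x)).
  by apply: eq_sint => y y1; rewrite -(Ec y y1) -EE; apply: eq_bigr => i _; rewrite expr2.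
have /= -> := sint_sum sigma_rot (index_enum _) (fun i => @continuous_evM R n (e i) (e i)).
rewrite (eq_bigr (fun=> 1)) ?sumr_const ?card_ord // => i _.
by rewrite -[LHS]/(<< e i, e i >>) (gram1P e1) eqxx.
Qed.

End OrthonormalBases.

(** * Comparison of ellipsoids *)

Lemma agm_ord (R : realFieldType) m (E : 'I_m -> R) : (forall i, 0 <= E i) ->
  \prod_i E i <= ((\sum_i E i) / m%:R) ^+ m ?= iff [forall i, forall j, E i == E j].
Proof. by move=> E0; have := @leif_AGM R _ xpredT E (fun i _ => E0 i); rewrite card_ord. Qed.

Section JohnEllipsoid.
Variables (R : realType) (n : nat) (sigma : probability (Rn R n) R) (k : nat).
Hypotheses (n_ge2 : (2 <= n)%N) (k_gt0 : (0 < k)%N) (sigma_rot : rot_inv_sphere_prob sigma).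
Implicit Types (p q f : {mpoly R[n]}) (x y : 'rV[R]_n).
Local Notation "<< p , q >>" := (inner sigma p q).
Local Notation D := (dimM n k).
Local Notation r2k := (r2k R n k).
Let rho : R := (Num.sqrt D%:R)^-1.
Let n_gt0 : (0 < n)%N := ltnW n_ge2.

(** Here [n >= 2] enters: the binomial coefficient is at least ['C(2k + 1, 2k) = 2k + 1], which
    exceeds 1. *)
Lemma dimM_gt0 : (0 < D)%N.
Proof.
rewrite /dimM subn_gt0; apply: (@leq_trans 'C((2 * k).+1, 2 * k)).
  by rewrite binSn ltnS muln_gt0.
by apply: leq_bin2l; rewrite ltn_subRL ltn_add2r.
Qed.

Lemma radiusE : 1 / Num.sqrt ('C(n + 2 * k - 1, 2 * k)%:R - 1) = rho.
Proof. by rewrite -(dimM_succ k n_gt0) -addn1 natrD addrK div1r. Qed.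

Lemma rho_gt0 : 0 < rho.
Proof. by rewrite invr_gt0 sqrtr_gt0 ltr0n dimM_gt0. Qed.

Lemma rho_sqr : rho ^+ 2 * D%:R = 1.
Proof.
by rewrite exprVn sqr_sqrtr ?ler0n // mulVf // pnatr_eq0 -lt0n dimM_gt0.
Qed.

(** * The ball of radius [rho] as an ellipsoid of nonnegative forms *)

Section Basis.
Variable e : 'I_D -> {mpoly R[n]}.
Hypotheses (M0e : forall i, M0 sigma k (e i)) (e1 : gram sigma e e = 1%:M).

Lemma inner_sum_orthonormal (c : 'I_D -> R) :
  << \sum_i c i *: e i, \sum_i c i *: e i >> = \sum_i c i ^+ 2.
Proof.
rewrite inner_suml //; apply: eq_bigr => i _.
by rewrite innerC (orthonormal_expansion sigma_rot _ _ e1) expr2.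
Qed.

Lemma M0_lincomb (c : 'I_D -> R) (a : 'I_D -> {mpoly R[n]}) :
  (forall i, M0 sigma k (a i)) -> M0 sigma k (\sum_i c i *: a i).
Proof.
move=> ha; split.
  by apply: rpred_sum => i _; apply: rpredZ; case: (ha i).
by rewrite sint_ev_sum // big1 // => i _; case: (ha i) => _ ->; rewrite mulr0.
Qed.

Lemma is_ellipsoid_param_ball : is_ellipsoid_param sigma r2k (fun i => rho *: e i).
Proof.
split; first by split; [exact: is_form_r2k|exact: sint_r2k].
move=> i; have [hi i0] := M0e i; split; first exact: rpredZ.
by rewrite sint_evZ // i0 mulr0.
Qed.

Lemma ball_ellipsoid :
  [set f | Mset sigma k f /\ pnorm sigma (f - r2k) <= rho] =
  ellipsoid r2k (fun i => rho *: e i).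
Proof.
have rho0 := rho_gt0; apply/seteqP; split => f /=.
  move=> [[hf f1] fn]; pose g := f - r2k.
  have M0g : M0 sigma k g.
    split; first by apply: rpredB => //; exact: is_form_r2k.
    by rewrite /g -scaleN1r sint_evD // sint_evZ // f1 sint_r2k // mulr1 subrr.
  (* By Parseval the coordinates of [g], rescaled by the semi-axis [rho], have sum of squares
     [<<g, g>> / rho ^+ 2]. *)
  exists (fun i => << g, e i >> / rho) => /=.
    under eq_bigr do rewrite exprMn.
    rewrite -mulr_suml -inner_sum_orthonormal -(orthonormal_M0_complete n_gt0 sigma_rot M0e e1 M0g).
    rewrite exprVn ler_pdivrMr ?exprn_gt0 // mul1r.
    rewrite -(@sqr_sqrtr _ <<g, g>>) ?inner_ge0 // ler_pXn2r // nnegrE ?sqrtr_ge0 //; exact: ltW.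
  under eq_bigr do rewrite scalerA divfK ?lt0r_neq0 //.
  by rewrite -(orthonormal_M0_complete n_gt0 sigma_rot M0e e1 M0g) /g addrC subrK.
move=> [u u1 <-].
have M0g : M0 sigma k (\sum_i u i *: (rho *: e i)).
  by apply: M0_lincomb; case: is_ellipsoid_param_ball.
split.
  split; first by apply: rpredD; [exact: is_form_r2k|case: M0g].
  by rewrite sint_evD // sint_r2k //; case: M0g => _ ->; rewrite addr0.
rewrite addrC addKr /pnorm.
under eq_bigr do rewrite scalerA.
rewrite inner_sum_orthonormal; under eq_bigr do rewrite exprMn.
rewrite -mulr_suml -[leRHS]ger0_norm ?(ltW rho0) // -sqrtr_sqr ler_wsqrtr //.
by rewrite ler_piMl // sqr_ge0.
Qed.

(** Homogeneity reduces nonnegativity to the sphere, where [f] is 1 plus the pairing of [u], of norm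
    at most 1, with [rho e(y)], of norm 1. *)
Lemma ball_subset_Cbar : ellipsoid r2k (fun i => rho *: e i) `<=` Cbar sigma k.
Proof.
have rho0 := rho_gt0.
move=> f fE; have : [set f | Mset sigma k f /\ pnorm sigma (f - r2k) <= rho] f.
  by rewrite ball_ellipsoid.
move=> /= [Mf _]; split => //; case: Mf => hf _; split => // x.
case: fE => u /= u1 fE.
have [->|/(ev_form_sphere hf)[y y1 ->]] := eqVneq x 0.
  by rewrite (ev_form0 _ hf) // muln_gt0.
apply: mulr_ge0; first by rewrite exprn_ge0 // sqrtr_ge0.
have se : \sum_i ev (e i) y ^+ 2 = D%:R.
  exact: (sum_sqr_orthonormal_M0 n_gt0 sigma_rot M0e e1).
have -> : ev f y = 1 + \sum_i u i * (rho * ev (e i) y).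
  rewrite -fE evD ev_r2k y1 expr1n ev_sum; congr (_ + _); apply: eq_bigr => i _.
  by rewrite !evZ.
(* AM-GM on each term: |u_i rho e_i| <= (u_i^2 + rho^2 e_i^2) / 2 *)
have : - ((\sum_i u i ^+ 2 + \sum_i rho ^+ 2 * ev (e i) y ^+ 2) / 2)
  <= \sum_i u i * (rho * ev (e i) y).
  rewrite -big_split mulr_suml -sumrN; apply: ler_sum => i _ /=.
  have := sqr_ge0 (u i + rho * ev (e i) y); nra.
rewrite -mulr_sumr se rho_sqr; lra.
Qed.

Lemma ell_volfactor_ball : ell_volfactor sigma (fun i => rho *: e i) = rho ^+ D.
Proof.
rewrite /ell_volfactor.
have -> : \matrix_(i, j) << rho *: e i, rho *: e j >> = (rho ^+ 2)%:M.
  apply/matrixP => i j; rewrite !mxE innerZl // innerC innerZl // innerC (gram1P e1).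
  by rewrite mulrA -expr2 mulr_natr.
by rewrite det_scalar -exprM mulnC exprM sqrtr_sqr ger0_norm // exprn_ge0 // ltW // rho_gt0.
Qed.

End Basis.

(** * An arbitrary ellipsoid of nonnegative forms *)

Section Comparison.
Variables (c : {mpoly R[n]}) (a : 'I_D -> {mpoly R[n]}).
Hypotheses (ca : is_ellipsoid_param sigma c a) (sub_Cbar : ellipsoid c a `<=` Cbar sigma k).

Lemma ellipsoid_ge0 (u : 'I_D -> R) x : \sum_i u i ^+ 2 <= 1 ->
  0 <= ev c x + \sum_i u i * ev (a i) x.
Proof.
move=> u1; have : Cbar sigma k (c + \sum_i u i *: a i) by apply: sub_Cbar; exists u.
move=> [[_ c0] _]; have := c0 x; rewrite evD ev_sum.
by under eq_bigr do rewrite evZ.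
Qed.

(** Nonnegativity at [x] is tested on the worst member of the ellipsoid, [u = - a(x) / |a(x)|],
    which gives [|a(x)| <= c(x)]. *)
Lemma sum_sqr_le_center x : \sum_i ev (a i) x ^+ 2 <= ev c x ^+ 2.
Proof.
set s := \sum_i _; have s0 : 0 <= s by apply: sumr_ge0 => i _; exact: sqr_ge0.
have c0 : 0 <= ev c x.
  have := @ellipsoid_ge0 (fun=> 0) x; rewrite !big1 ?addr0; first by apply.
    by move=> i _; rewrite mul0r.
  by move=> i _; rewrite expr0n.
have [->|sn0] := eqVneq s 0; first exact: sqr_ge0.
have sq0 : 0 < Num.sqrt s by rewrite sqrtr_gt0 lt_neqAle eq_sym sn0.
have := @ellipsoid_ge0 (fun i => - (ev (a i) x / Num.sqrt s)) x.
under eq_bigr do rewrite sqrrN exprMn exprVn sqr_sqrtr //.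
rewrite -mulr_suml mulfV // => /(_ (lexx _)).
under eq_bigr do rewrite mulNr mulrAC -expr2.
rewrite sumrN -mulr_suml -/s -{1}(sqr_sqrtr s0) expr2 mulfK ?lt0r_neq0 // subr_ge0 => sc.
by rewrite -(sqr_sqrtr s0) ler_pXn2r // nnegrE ltW.
Qed.

Variable L : 'M[R]_D.
Let e := lincomb (invmx L) a.
Hypotheses (trigL : is_trig_mx L) (Lpos : forall i, 0 < L i i)
  (GL : gram sigma a a = L *m L^T) (e1 : gram sigma e e = 1%:M)
  (aE : forall i, a i = lincomb L e i).

Let M0e i : M0 sigma k (e i).
Proof. by apply: M0_lincomb; case: ca. Qed.

(** Value at [x] of [c + sum_i u_i a_i] for [u = - rho e(x)]. The parameter moves with [x], so this
    is not one fixed form of the ellipsoid. *)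
Let defect x := ev c x - rho * \sum_i ev (a i) x * ev (e i) x.

Lemma continuous_sum_evM : continuous (fun x => \sum_i ev (a i) x * ev (e i) x).
Proof. by apply: continuous_sum => i; exact: continuous_evM. Qed.

Lemma continuous_scaled_sum_evM r : continuous (fun x => r * \sum_i ev (a i) x * ev (e i) x).
Proof.
by move=> x; apply: continuousM; [exact: cst_continuous|exact: continuous_sum_evM].
Qed.

Lemma continuous_defect : continuous defect.
Proof.
by move=> x; apply: continuousB; [exact: continuous_ev|exact: continuous_scaled_sum_evM].
Qed.

(** On the sphere the squares of the [e i] sum to [D], so [rho e(x)] has norm 1 and the parameter is
    admissible. *)
Lemma defect_ge0 x : sqnorm x = 1 -> 0 <= defect x.
Proof.
move=> x1; rewrite /defect mulr_sumr -sumrN.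
rewrite (eq_bigr (fun i => - (rho * ev (e i) x) * ev (a i) x)) => [|i _]; last by ring.
apply: ellipsoid_ge0; under eq_bigr do rewrite sqrrN exprMn.
by rewrite -mulr_sumr (sum_sqr_orthonormal_M0 n_gt0 sigma_rot M0e e1 x1) rho_sqr.
Qed.

(** [c] has mean 1, and the inner product of [a i] with [e i] is the diagonal coefficient
    [L i i]. *)
Lemma sint_defect : sint sigma defect = 1 - rho * \sum_i L i i.
Proof.
have -> : defect = (fun x => ev c x + (- rho) * \sum_i ev (a i) x * ev (e i) x).
  by apply/funext => x; rewrite /defect mulNr.
rewrite sintD; [|exact: continuous_ev|exact: continuous_scaled_sum_evM].
rewrite sintZ; last exact: continuous_sum_evM.
have [[_ ->] _] := ca; rewrite mulNr; congr (1 - rho * _).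
have /= -> := sint_sum sigma_rot (index_enum _) (fun i => @continuous_evM R n (a i) (e i)).
apply: eq_bigr => i _; rewrite -[LHS]/(<< a i, e i >>) aE.
by rewrite (orthonormal_expansion sigma_rot _ _ e1).
Qed.

Lemma ell_volfactorE : ell_volfactor sigma a = \prod_i L i i.
Proof.
rewrite /ell_volfactor -/(gram sigma a a) GL det_mulmx det_tr det_trig // -expr2 sqrtr_sqr.
by rewrite ger0_norm // prodr_ge0 // => i _; exact: ltW.
Qed.

Lemma trace_le : \sum_i L i i <= D%:R * rho.
Proof.
have : 0 <= 1 - rho * \sum_i L i i.
  by rewrite -sint_defect; apply: Rintegral_ge0 => x; exact: defect_ge0.
have := rho_sqr; have := rho_gt0; set t := \sum_i _; move=> r0 r2 h.
rewrite -(ler_pM2l r0) mulrCA -expr2 mulrC -[X in _ <= X]mulrC; lra.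
Qed.

Lemma prod_le_rho : \prod_i L i i <= rho ^+ D.
Proof.
apply: le_trans (agm_ord (fun i => ltW (Lpos i))) _.
have D0 : 0 < D%:R :> R by rewrite ltr0n dimM_gt0.
rewrite lerXn2r // ?nnegrE ?(ltW rho_gt0) //; last by rewrite ler_pdivrMr // mulrC trace_le.
by apply: divr_ge0; [apply: sumr_ge0 => i _; exact: ltW|exact: ltW].
Qed.

(** The mean [t] of the diagonal is squeezed: [rho ^+ D <= prod_i L_ii <= t ^+ D <= rho ^+ D]. Hence
    [t = rho], and equality in AM-GM makes all entries equal to their mean. *)
Lemma prod_eq_rho : rho ^+ D <= \prod_i L i i -> forall i, L i i = rho.
Proof.
move=> rhoL; have D0 : 0 < D%:R :> R by rewrite ltr0n dimM_gt0.
pose t := (\sum_i L i i) / D%:R.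
have t_le : t <= rho by rewrite ler_pdivrMr // mulrC trace_le.
have t0 : 0 <= t by apply: divr_ge0; [apply: sumr_ge0 => i _; exact: ltW|exact: ltW].
have agm := agm_ord (fun i => ltW (Lpos i)).
have tX : rho ^+ D <= t ^+ D := le_trans rhoL agm.
have tE : t = rho.
  by apply/eqP; rewrite eq_le t_le -(@ler_pXn2r _ D) ?nnegrE ?dimM_gt0 // ltW // rho_gt0.
have : \prod_i L i i == t ^+ D by rewrite eq_le agm tE rhoL.
rewrite agm => /forallP Leq i.
have Li j : L j j = L i i by exact/eqP/(forallP (Leq j)).
rewrite -tE /t (eq_bigr (fun=> L i i)) // sumr_const card_ord -[L i i *+ _]mulr_natr mulfK //.
exact: lt0r_neq0.
Qed.

Lemma extremal_axes : (forall i, L i i = rho) -> c = r2k /\ forall i, a i = rho *: e i.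
Proof.
move=> Lrho; have rho0 := rho_gt0; have rho2 := rho_sqr.
have hc : is_form (2 * k) c by case: ca => [[]].
have ha i : is_form (2 * k) (a i) by case: ca => _ /(_ i)[].
have he i : is_form (2 * k) (e i) by case: (M0e i).
(* The trace is now [D * rho], so the defect, even and nonnegative on the sphere, has integral
   [1 - rho ^+ 2 * D = 0]. *)
have defect0 x : sqnorm x = 1 -> defect x = 0.
  apply: (sint_eq0 sigma_rot continuous_defect) => [y||]; last 2 first.
  - exact: defect_ge0.
  - rewrite sint_defect; under eq_bigr do rewrite Lrho.
    by rewrite sumr_const card_ord -mulr_natr mulrA -expr2 rho2 subrr.
  rewrite /defect (ev_formN _ hc); congr (_ - _ * _).
  by apply: eq_bigr => i _; rewrite (ev_formN _ (ha i)) (ev_formN _ (he i)).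
have sphere_eq x : sqnorm x = 1 -> forall i, ev (a i) x = rho * ev c x * ev (e i) x.
  move=> x1.
  have se := sum_sqr_orthonormal_M0 n_gt0 sigma_rot M0e e1 x1.
  have cE : ev c x = rho * \sum_i ev (a i) x * ev (e i) x.
    by apply/eqP; rewrite -subr_eq0; apply/eqP; exact: defect0.
  (* The vanishing defect and [rho ^+ 2 * D = 1] turn [|a - rho c e|^2] into [|a|^2 - 2 c^2 + c^2],
     which [|a| <= c] bounds by 0. *)
  have : \sum_i (ev (a i) x - rho * ev c x * ev (e i) x) ^+ 2 <= 0.
    have -> : \sum_i (ev (a i) x - rho * ev c x * ev (e i) x) ^+ 2 =
      \sum_i ev (a i) x ^+ 2 - 2 * ev c x * (rho * \sum_i ev (a i) x * ev (e i) x)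
      + ev c x ^+ 2 * (rho ^+ 2 * \sum_i ev (e i) x ^+ 2).
      move: (ev c x) => cx; rewrite !mulr_sumr -sumrN -!big_split; apply: eq_bigr => i _ /=; ring.
    rewrite -cE se rho2; have := sum_sqr_le_center x; nra.
  rewrite le_eqVlt ltNge sumr_ge0 => [|i _]; last exact: sqr_ge0.
  rewrite orbF psumr_eq0 => [/allP z i|i _]; last exact: sqr_ge0.
  by have := z i (mem_index_enum i); rewrite /= sqrf_eq0 subr_eq0 => /eqP.
have c1 x : sqnorm x = 1 -> ev c x = 1.
  move=> x1.
  have se := sum_sqr_orthonormal_M0 n_gt0 sigma_rot M0e e1 x1.
  have /existsP[i0 ei0] : [exists i, ev (e i) x != 0].
    rewrite -negb_forall; apply/negP => /forallP z.
    move: se; rewrite big1 => [|i _]; last by rewrite (eqP (z i)) expr0n.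
    by move/eqP; rewrite eq_sym pnatr_eq0 -leqn0 leqNgt dimM_gt0.
  (* For the least [i] with [e i] nonzero at [x], only [L i i = rho] contributes to [a i]: earlier
     [e j] vanish there and later coefficients are zero. Comparison with [a i = rho c e i] gives
     [c = 1] at [x]. *)
  case: (@arg_minnP _ i0 (fun i => ev (e i) x != 0) val ei0) => i ei imin.
  have := sphere_eq x x1 i; rewrite aE ev_lincomb (bigD1 i) //= big1 => [|j ji]; last first.
    have [ji'|ij] := ltnP j i.
      have [->|/imin] := eqVneq (ev (e j) x) 0; first by rewrite mulr0.
      by rewrite /= leqNgt ji'.
    rewrite (is_trig_mxP trigL) ?mul0r // ltn_neqAle ij andbT.
    by apply: contra ji => /eqP/val_inj ->.
  rewrite addr0 Lrho => /(mulIf ei)/eqP; rewrite -{1}[rho]mulr1.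
  by move=> /eqP/(mulfI (lt0r_neq0 rho0)) <-.
split.
  apply/eqP; rewrite -subr_eq0; apply/eqP; apply: (@form_sphere_eq0 R n (2 * k)).
  - by rewrite muln_gt0.
  - by apply: rpredB => //; exact: is_form_r2k.
  by move=> x x1; rewrite evB ev_r2k x1 expr1n c1 // subrr.
move=> i; apply/eqP; rewrite -subr_eq0; apply/eqP; apply: (@form_sphere_eq0 R n (2 * k)).
- by rewrite muln_gt0.
- by apply: rpredB; [exact: ha|apply: rpredZ; exact: he].
by move=> x x1; rewrite evB evZ sphere_eq // c1 // mulr1 subrr.
Qed.

End Comparison.

End JohnEllipsoid.

(** * Maximality and uniqueness of the ball *)

Unset Implicit Arguments.
Set Strict Implicit.

Theorem theorem5p3 (R : realType) (n k : nat) (sigma : probability (Rn R n) R) :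
  (2 <= n)%N -> (1 <= k)%N -> rot_inv_sphere_prob sigma ->
  let rho : R := 1 / Num.sqrt ('C(n + 2 * k - 1, 2 * k)%:R - 1) in
  let ball := [set f | Mset sigma k f /\ pnorm sigma (f - r2k R n k) <= rho] in
  is_John_ellipsoid sigma k (Cbar sigma k) ball /\
  (forall E, is_John_ellipsoid sigma k (Cbar sigma k) E -> E = ball).
Proof.
move=> n2 k1 sigma_rot rho ball.
have n_gt0 : (0 < n)%N := ltnW n2.
have [e [M0e e1]] := exists_orthonormal_M0 n_gt0 k1 sigma_rot.
pose a0 i : {mpoly R[n]} := rho *: e i.
have rhoE : rho = (Num.sqrt (dimM n k)%:R)^-1 := radiusE R k n2.
have ballE : ball = ellipsoid (r2k R n k) a0.
  by rewrite /ball /a0 rhoE; exact: ball_ellipsoid.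
have param0 : is_ellipsoid_param sigma (r2k R n k) a0.
  by rewrite /a0 rhoE; exact: is_ellipsoid_param_ball.
have sub0 : ellipsoid (r2k R n k) a0 `<=` Cbar sigma k.
  by rewrite /a0 rhoE; exact: ball_subset_Cbar.
have vol0 : ell_volfactor sigma a0 = rho ^+ dimM n k.
  by rewrite /a0 rhoE; exact: ell_volfactor_ball.
have rho_gt0 : 0 < rho by rewrite rhoE; exact: rho_gt0.
have gs a : (forall i, M0 sigma k (a i)) -> \det (gram sigma a a) != 0 -> _ :=
  fun ha => gram_schmidt sigma_rot k1 (fun i => proj1 (ha i)).
split.
  exists (r2k R n k), a0; split => //; first by rewrite ballE.
  move=> c a ca sub; rewrite vol0.
  have [det0|/(gs _ _ (proj2 ca))[L [trigL Lpos GL h1 aE]]] := eqVneq (\det (gram sigma a a)) 0.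
    by rewrite /ell_volfactor -/(gram sigma a a) det0 sqrtr0 exprn_ge0 // ltW.
  rewrite (ell_volfactorE trigL Lpos GL) rhoE.
  exact: (prod_le_rho n2 k1 sigma_rot ca sub Lpos h1 aE).
move=> E [c [a [ca -> sub max]]].
have := max _ _ param0 sub0; rewrite vol0 => vola.
(* A maximal ellipsoid has at least the positive volume factor of the ball, so its axes are
   independent. *)
have det0 : \det (gram sigma a a) != 0.
  apply/eqP => det0; move: vola.
  by rewrite /ell_volfactor -/(gram sigma a a) det0 sqrtr0 leNgt exprn_gt0.
have [L [trigL Lpos GL h1 aE]] := gs _ _ (proj2 ca) det0.
move: vola; rewrite (ell_volfactorE trigL Lpos GL) rhoE => vola.
have Lrho := prod_eq_rho n2 k1 sigma_rot ca sub Lpos h1 aE vola.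
have [-> aE'] := extremal_axes n2 k1 sigma_rot ca sub trigL h1 aE Lrho.
(* The ball has the same description in every orthonormal basis of [M0], so the basis obtained from
   [a] may replace the initial one. *)
rewrite /ball rhoE (ball_ellipsoid n2 k1 sigma_rot _ h1); last first.
  by move=> i; apply: M0_lincomb => //; case: ca.
by congr ellipsoid; apply/funext.
Qed.
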